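(* Any gyroelongated bipyramid is coherently labellable.
   Context: An $n$-sided antiprism ($n\ge 3$) is a polyhedron composed of two parallel copies of an $n$-sided polygon connected by an alternating band of $2n$ triangles. A gyroelongated bipyramid is a polyhedron obtained by elongating an $n$-gonal bipyramid by inserting an $n$-gonal antiprism between its congruent halves; that is, a pyramid over an $n$-gon is attached to each of the two $n$-gonal faces of the antiprism, those two faces vanishing while their edges remain, so that all faces are triangles (for example, the icosahedron is the case $n=5$). Faces are oriented by the outward normal, so boundary edges are traversed anticlockwise as seen from outside. A labelling of all the edges by integers is coherent if, for each face $F$ with $n_F$ edges, there is a choice of starting edge such that the successive labels read anticlockwise from that edge satisfy $a_1<a_2<\cdots<a_{n_F}$. The polyhedron is coherently labellable if it has a coherent labelling. *)

(* Defs.v *)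
From mathcomp Require Import all_boot all_order all_algebra.
From mathcomp Require Import zify.

Set Implicit Arguments.
Unset Strict Implicit.
Unset Printing Implicit Defensive.

(* A polyhedron enters only through its oriented boundary complex: its vertices
   and its faces, each face being the cycle of its vertices in the order in
   which they are met anticlockwise as seen from outside.  Such a cycle is
   meaningful up to rotation only, see [has_face]. *)
Record face_complex := FaceComplex {
  vertex : finType;
  faces : seq (seq vertex)
}.

(* The directed edges traversed by the closed walk [f]:
   [:: (f_0, f_1); (f_1, f_2); ...; (f_(k-1), f_0)]. *)
Definition darts (T : Type) (f : seq T) : seq (T * T) := zip f (rot 1 f).

Definition all_darts (C : face_complex) : seq (vertex C * vertex C) :=
  flatten [seq darts f | f <- faces C].

(* Faces are simple polygons, and every edge lies on exactly two faces, which
   traverse it in opposite directions. *)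
Definition closed_surface (C : face_complex) : Prop :=
  [/\ forall f, f \in faces C -> 2 < size f /\ uniq f,
      uniq (all_darts C),
      forall x y, (x, y) \in all_darts C -> (y, x) \in all_darts C
    & forall x : vertex C, exists2 f, f \in faces C & x \in f].

Record polyhedron := Polyhedron {
  complex :> face_complex;
  complex_closed : closed_surface complex
}.

(* An edge is the unordered pair of its endpoints; these are the edges of the
   face [f] in anticlockwise order. *)
Definition face_edges (T : finType) (f : seq T) : seq {set T} :=
  [seq [set e.1; e.2] | e <- darts f].

(* The values of [lab] on sets which are not edges are irrelevant. *)
Definition coherent (P : polyhedron) (lab : {set vertex P} -> int) : Prop :=
  forall f, f \in faces P ->
    exists k : nat,
      sorted (fun a b : int => (a < b)%R) (rot k [seq lab e | e <- face_edges f]).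

Definition coherently_labellable (P : polyhedron) : Prop :=
  exists lab : {set vertex P} -> int, coherent lab.

Definition has_face (C : face_complex) (f : seq (vertex C)) : Prop :=
  exists k : nat, rot k f \in faces C.

Definition isomorphic (C D : face_complex) : Prop :=
  exists2 phi : vertex C -> vertex D, bijective phi &
    forall f, has_face f <-> has_face (map phi f).

(* Antiprism: top polygon inl 0, ..., inl (n-1), anticlockwise seen from above;
   bottom polygon inr 0, ..., inr (n-1), indexed in the same sense, hence
   reversed when seen from below; inr i lies between inl i and inl (i+1). *)
Definition antiprism_top (n : nat) : seq ('I_n + 'I_n) :=
  [seq inl i | i <- enum 'I_n].

Definition antiprism_bottom (n : nat) : seq ('I_n + 'I_n) :=
  rev [seq inr i | i <- enum 'I_n].

Definition antiprism_band (n : nat) : seq (seq ('I_n + 'I_n)) :=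
  [seq [:: inl (ordS i); inl i; inr i] | i <- enum 'I_n] ++
  [seq [:: inr i; inr (ordS i); inl (ordS i)] | i <- enum 'I_n].

Definition antiprism (n : nat) : face_complex :=
  {| vertex := ('I_n + 'I_n)%type;
     faces := antiprism_top n :: antiprism_bottom n :: antiprism_band n |}.

(* The face [f] is replaced by the triangles joining its edges to a new
   vertex, the apex [None]. *)
Definition attach_pyramid (C : face_complex) (f : seq (vertex C)) :
    face_complex :=
  {| vertex := option (vertex C);
     faces := [seq map Some g | g <- faces C & g != f] ++
              [seq [:: None; Some e.1; Some e.2] | e <- darts f] |}.

Definition gyroelongated_bipyramid_complex (n : nat) : face_complex :=
  @attach_pyramid (@attach_pyramid (antiprism n) (antiprism_top n))
    (map Some (antiprism_bottom n)).

(* The indexing of the antiprism loses no generality: the top polygon can always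
   be indexed anticlockwise from outside, and the bottom vertices so that the
   one between inl i and inl (i+1) has index i. *)
Definition is_gyroelongated_bipyramid (n : nat) (P : polyhedron) : Prop :=
  isomorphic P (gyroelongated_bipyramid_complex n).

(* The complexes above are closed surfaces, so gyroelongated bipyramids exist. *)
Lemma darts_map (T U : Type) (h : T -> U) (f : seq T) :
  darts (map h f) = [seq (h e.1, h e.2) | e <- darts f].
Proof.
rewrite /darts -map_rot.
by elim: f (rot 1 f) => [|x s IHs] [|y t] //=; rewrite IHs.
Qed.

Lemma darts_enum_ord (n : nat) :
  darts (enum 'I_n) = [seq (i, ordS i) | i <- enum 'I_n].
Proof.
case: n => [|n].
  by rewrite (size0nil (size_enum_ord 0)).
have sz : size (enum 'I_n.+1) = n.+1 by rewrite size_enum_ord.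
apply: (@eq_from_nth _ (ord0, ord0)).
  by rewrite size_map size_zip size_rot minnn.
move=> i; rewrite size_zip size_rot minnn sz => lt_in.
rewrite nth_zip ?size_rot // (nth_map ord0) ?sz //.
congr (_, _); apply/val_inj; rewrite /= nth_enum_ord //.
rewrite /rot nth_cat size_drop sz subn1 /=.
case: ltnP => [lt_i|le_i].
  by rewrite nth_drop add1n nth_enum_ord // modn_small.
have -> : i = n by apply/eqP; rewrite eqn_leq le_i -ltnS lt_in.
by rewrite subnn modnn nth_take // nth_enum_ord.
Qed.

Lemma perm_darts_rev (T : eqType) (f : seq T) :
  perm_eq (darts (rev f)) [seq (e.2, e.1) | e <- darts f].
Proof.
have -> : [seq (e.2, e.1) | e <- darts f] = zip (rot 1 f) f.
  by rewrite /darts; elim: f (rot 1 f) => [|x s IHs] [|y t] //=; rewrite IHs.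
rewrite perm_sym -perm_rev rev_zip ?size_rot // /darts.
case: f => [|x s] //; rewrite rot1_cons rev_rcons rev_cons.
case: (rev s) => [|y t] //=; rewrite rot1_cons.
by rewrite -rcons_cons zip_rcons ?size_rcons // perm_sym perm_rcons.
Qed.

Lemma perm_flatten3 (S : Type) (T : eqType) (a b c : S -> T) (s : seq S) :
  perm_eq (flatten [seq [:: a e; b e; c e] | e <- s])
          (map a s ++ map b s ++ map c s).
Proof.
apply/permP=> p; rewrite !count_cat.
by elim: s => [|e s IHs] //=; rewrite IHs; lia.
Qed.

Lemma size_darts (T : Type) (f : seq T) : size (darts f) = size f.
Proof. by rewrite size_zip size_rot minnn. Qed.

Lemma unzip1_darts (T : Type) (f : seq T) : unzip1 (darts f) = f.
Proof. by rewrite unzip1_zip ?size_rot. Qed.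

Lemma unzip2_darts (T : Type) (f : seq T) : unzip2 (darts f) = rot 1 f.
Proof. by rewrite unzip2_zip ?size_rot. Qed.

Lemma darts_neq (T : eqType) (f : seq T) :
  2 < size f -> uniq f -> forall x y, (x, y) \in darts f -> x != y.
Proof.
move=> sz uf x y; have [x0 _] : exists x0 : T, x0 == x by exists x.
move=> /(nthP (x0, x0))[i]; rewrite size_darts => lt_i.
rewrite nth_zip ?size_rot // => -[<- <-].
rewrite /rot nth_cat size_drop.
case: ltnP => [lt_i1|le_i].
  by rewrite nth_drop nth_uniq //; lia.
by rewrite nth_take ?nth_uniq //; lia.
Qed.

Lemma perm_attach_darts (C : face_complex) (f : seq (vertex C)) :
  closed_surface C -> f \in faces C ->
  perm_eq (all_darts (attach_pyramid f))
    ([seq (Some e.1, Some e.2) | e <- all_darts C] ++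
     [seq (None, Some x) | x <- f] ++ [seq (Some x, None) | x <- rot 1 f]).
Proof.
case=> faceC uniqC _ _ fC.
have uf : uniq (faces C).
  move: uniqC (fun f fC => (faceC f fC).1); rewrite /all_darts.
  elim: (faces C) => //= g s IHs; rewrite cat_uniq => /and3P[_ dis us] sz.
  rewrite IHs // ?andbT; last by move=> h hs; rewrite sz // inE hs orbT.
  apply/negP=> gs; case/hasP: dis.
  have: 2 < size g by rewrite sz ?mem_head.
  rewrite -size_darts; case E: (darts g) => [|e t] // _.
  exists e; last by rewrite /= mem_head.
  by apply/flattenP; exists (darts g); rewrite ?map_f // E mem_head.
have pf : perm_eq (faces C) (f :: [seq g <- faces C | g != f]).
  have -> : [seq g <- faces C | g != f] = rem f (faces C) by rewrite rem_filter.
  exact: perm_to_rem.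
have pC : perm_eq (all_darts C)
    (darts f ++ flatten [seq darts g | g <- faces C & g != f]).
  exact: (perm_flatten (perm_map _ pf)).
pose S (e : vertex C * vertex C) := (Some e.1, Some e.2).
have dS : [seq darts g | g <- [seq map Some g | g <- faces C & g != f]] =
          [seq map S (darts g) | g <- faces C & g != f].
  by rewrite -map_comp; apply: eq_map => g /=; rewrite darts_map.
have dT : [seq darts g | g <- [seq [:: None; Some e.1; Some e.2] | e <- darts f]]
    = [seq [:: (None, Some e.1); S e; (Some e.2, None)] | e <- darts f].
  by rewrite -map_comp; apply: eq_map => g.
rewrite /all_darts /= map_cat flatten_cat dS dT.
have -> : [seq (None, Some x) | x <- f] = 
    [seq (None, Some e.1) | e <- darts f] :> seq (option (vertex C) * _).
  by rewrite -{1}(unzip1_darts f) -map_comp.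
have -> : [seq (Some x, None) | x <- rot 1 f] = 
    [seq (Some e.2, None) | e <- darts f] :> seq (_ * option (vertex C)).
  by rewrite -unzip2_darts -map_comp.
have -> : flatten [seq map S (darts g) | g <- faces C & g != f] =
          map S (flatten [seq darts g | g <- faces C & g != f]).
  by rewrite map_flatten -map_comp.
set U := flatten [seq [:: _; _; _] | _ <- _].
have pU : perm_eq U _ := perm_flatten3 _ _ _ _.
rewrite (permPl (perm_cat (perm_refl _) pU)) (permPr (perm_cat (perm_map S pC)
  (perm_refl _))) map_cat -!catA perm_sym perm_catCA perm_cat2l.
by rewrite perm_catCA.
Qed.

Lemma attach_pyramid_closed (C : face_complex) (f : seq (vertex C)) :
  closed_surface C -> f \in faces C -> closed_surface (attach_pyramid f).
Proof.
move=> cC fC; have pD := perm_attach_darts cC fC.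
case: cC => faceC uniqC symC covC; have [szf uf] := faceC f fC.
have loopless := darts_neq szf uf.
split.
- move=> g; rewrite mem_cat => /orP[/mapP[h]|/mapP[[x y] exy ->]].
    rewrite mem_filter => /andP[_ /faceC[szh uh]] ->.
    by rewrite size_map map_inj_uniq // => x y [].
  split=> //=; rewrite !inE /= andbT.
  exact: loopless exy.
- rewrite (perm_uniq pD) !cat_uniq !map_inj_uniq ?rot_uniq ?uniqC ?uf /=;
    try by move=> [??] [??] [-> ->]. 
  all: try by move=> ? ? [].
  rewrite andbT; apply/andP; split; apply/hasPn => e.
    rewrite mem_cat => /orP[] /mapP[x _ ->]; apply/mapP => -[[? ?] _ //].
  by move=> /mapP[x _ ->]; apply/mapP => -[? _ //].
- move=> x y; rewrite !(perm_mem pD) !mem_cat.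
  case/or3P => /mapP[e eC [-> ->]].
  + case: e eC => a b /symC; move/(map_f (fun e => (Some e.1, Some e.2))) => /= ->.
    by [].
  + by rewrite [X in _ || (_ || X)]map_f ?mem_rot // !orbT.
  + by rewrite [X in _ || (X || _)]map_f ?orbT // -(mem_rot 1).
have tri x : x \in f -> exists y, [:: None; Some x; Some y] \in faces (attach_pyramid f).
  rewrite -{1}(unzip1_darts f) => /mapP[[a b] ab ->]; exists b.
  by rewrite mem_cat [X in _ || X](map_f (fun e => [:: None; Some e.1; Some e.2]) ab) orbT.
case=> [x|].
  have [g gC xg] := covC x; have [Eg|ng] := eqVneq g f.
    rewrite Eg in xg; have [y yC] := tri x xg.
    by exists [:: None; Some x; Some y]; rewrite // !inE eqxx orbT.
  exists (map Some g); last exact: map_f.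
  by rewrite mem_cat map_f // mem_filter ng.
have [x xf] : exists x, x \in f by case: (f) szf => // x s _; exists x; rewrite mem_head.
by have [y yC] := tri x xf; exists [:: None; Some x; Some y].
Qed.

Lemma perm_antiprism_darts (n : nat) :
  perm_eq (all_darts (antiprism n))
    ([seq (inl i, inl (ordS i)) | i <- enum 'I_n] ++ [seq (inr (ordS i), inr i) | i <- enum 'I_n] ++
     ([seq (inl (ordS i), inl i) | i <- enum 'I_n] ++ [seq (inl i, inr i) | i <- enum 'I_n] ++
      [seq (inr i, inl (ordS i)) | i <- enum 'I_n]) ++
     ([seq (inr i, inr (ordS i)) | i <- enum 'I_n] ++
      [seq (inr (ordS i), inl (ordS i)) | i <- enum 'I_n] ++
      [seq (inl (ordS i), inr i) | i <- enum 'I_n])).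
Proof.
change (all_darts (antiprism n)) with (darts (antiprism_top n) ++
  darts (antiprism_bottom n) ++ flatten [seq darts f | f <- antiprism_band n]).
rewrite map_cat flatten_cat.
apply: perm_cat.
  rewrite darts_map darts_enum_ord -(map_comp _ _ (enum 'I_n)).
  exact: perm_refl.
apply: perm_cat.
  apply: perm_trans (perm_darts_rev _) _.
  rewrite darts_map darts_enum_ord -map_comp -(map_comp _ _ (enum 'I_n)).
  exact: perm_refl.
apply: perm_cat; rewrite -(map_comp _ _ (enum 'I_n)); exact: perm_flatten3.
Qed.

Lemma ordS_neq (n : nat) (i : 'I_n) : 2 < n -> ordS i != i.
Proof.
move=> n_gt2; apply/eqP => /(congr1 val) /=; have := ltn_ord i.
rewrite leq_eqVlt => /predU1P[Ei|lt_i]; first by rewrite Ei modnn; lia.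
by rewrite modn_small //; lia.
Qed.

Lemma ordS2_neq (n : nat) (i : 'I_n) : 2 < n -> ordS (ordS i) != i.
Proof.
move=> n_gt2; apply/eqP => /(congr1 val) /=; have := ltn_ord i.
rewrite leq_eqVlt => /predU1P[Ei|lt_i].
  by rewrite Ei modnn modn_small; lia.
rewrite (@modn_small i.+1) //; move: lt_i.
rewrite leq_eqVlt => /predU1P[Ei|lt_i]; first by rewrite Ei modnn; lia.
by rewrite modn_small //; lia.
Qed.

Lemma uniq_antiprism_darts (n : nat) : 2 < n -> uniq (all_darts (antiprism n)).
Proof.
move=> n_gt2; have pD := perm_antiprism_darts n.
have nS i := negPf (ordS_neq i n_gt2); have nSS i := negPf (ordS2_neq i n_gt2).
have injS := can_inj (@ordSK n).
have inj_inl : injective (@inl 'I_n 'I_n) by move=> ? ? [].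
have inj_inr : injective (@inr 'I_n 'I_n) by move=> ? ? [].
have U (T : eqType) (g : 'I_n -> T) : injective g -> uniq (map g (enum 'I_n)).
  by move=> inj_g; rewrite map_inj_uniq //; exact: enum_uniq.
rewrite (perm_uniq pD) !cat_uniq.
repeat (apply/andP; split).
all: try by apply: U => x y [].
all: try by apply: U => x y [] *; apply/injS/val_inj.
all: apply/hasPn => e; rewrite ?mem_cat -?orbA => He; apply/negP; move: He.
all: repeat (move=> /orP[]).
all: move=> /mapP[i _ ->]; rewrite ?mem_cat -?orbA => /= Hj.
all: repeat (case/orP: Hj => Hj).
all: case/mapP: Hj => j _ //.
all: move/eqP; rewrite xpair_eqE ?(inj_eq inj_inl) ?(inj_eq inj_inr).
all: case/andP => /eqP Ei /eqP Ej.
all: by move: (ordS_neq i n_gt2) (ordS_neq j n_gt2) (ordS2_neq i n_gt2) (ordS2_neq j n_gt2)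
  => /eqP ? /eqP ? /eqP ? /eqP ?; congruence.
Qed.

Lemma antiprism_closed (n : nat) : 2 < n -> closed_surface (antiprism n).
Proof.
move=> n_gt2; have pD := perm_antiprism_darts n.
have inj_inl : injective (@inl 'I_n 'I_n) by move=> ? ? [].
have inj_inr : injective (@inr 'I_n 'I_n) by move=> ? ? [].
have U (T : eqType) (g : 'I_n -> T) : injective g -> uniq (map g (enum 'I_n)).
  by move=> inj_g; rewrite map_inj_uniq //; exact: enum_uniq.
have M (T : eqType) (g : 'I_n -> T) i : g i \in map g (enum 'I_n).
  by apply: map_f; rewrite mem_enum.
split.
- move=> f; rewrite !inE mem_cat.
  case/or4P => [/eqP->|/eqP->|/mapP[i _ ->]|/mapP[i _ ->]].
  + by rewrite size_map size_enum_ord U.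
  + by rewrite size_rev rev_uniq size_map size_enum_ord U.
  + by split=> //=; rewrite !inE (inj_eq inj_inl) (negPf (ordS_neq i n_gt2)).
  + by split=> //=; rewrite !inE (inj_eq inj_inr) eq_sym (negPf (ordS_neq i n_gt2)).
- exact: uniq_antiprism_darts.
- move=> x y; rewrite !(perm_mem pD) !mem_cat -!orbA.
  case/orP => [|/orP[|/orP[|/orP[|/orP[|/orP[|/orP[|]]]]]]] /mapP[i _ [-> ->]].
  + by rewrite (M _ (fun i => (inl (ordS i), inl i))) ?orbT.
  + by rewrite (M _ (fun i => (inr i, inr (ordS i)))) ?orbT.
  + by rewrite (M _ (fun i => (inl i, inl (ordS i)))) ?orbT.
  + rewrite -(ord_predK i).
    by rewrite (M _ (fun i => (inr (ordS i), inl (ordS i)))) ?orbT.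
  + by rewrite (M _ (fun i => (inl (ordS i), inr i))) ?orbT.
  + by rewrite (M _ (fun i => (inr (ordS i), inr i))) ?orbT.
  + by rewrite (M _ (fun i => (inl i, inr i))) ?orbT.
  + by rewrite (M _ (fun i => (inr i, inl (ordS i)))) ?orbT.
case=> i.
  by exists (antiprism_top n); rewrite ?mem_head //; exact: M.
by exists (antiprism_bottom n); rewrite ?inE ?eqxx ?orbT // mem_rev; exact: M.
Qed.

Lemma gyroelongated_bipyramid_complex_closed (n : nat) :
  2 < n -> closed_surface (gyroelongated_bipyramid_complex n).
Proof.
move=> n_gt2; apply: attach_pyramid_closed.
  by apply: attach_pyramid_closed (antiprism_closed n_gt2) _; rewrite mem_head.
rewrite mem_cat; apply/orP; left; apply: map_f.
rewrite mem_filter !inE eqxx orbT andbT.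
case: n n_gt2 => // n _; apply/eqP => /(congr1 (fun s => inl ord0 \in s)).
rewrite mem_rev [X in _ = X]map_f ?mem_enum //.
by move/mapP=> [].
Qed.

Lemma gyroelongated_bipyramid_exists (n : nat) :
  2 < n -> exists P : polyhedron, is_gyroelongated_bipyramid n P.
Proof.
move=> n_gt2.
exists (Polyhedron (gyroelongated_bipyramid_complex_closed n_gt2)), id.
  by exists id.
by move=> f; rewrite map_id.
Qed.

(* Main.v *)
Require Import Defs.
From mathcomp Require Import all_boot all_order all_algebra.
From mathcomp Require Import zify.

(** Let the apexes be T and B, the top polygon t_0, ..., t_(n-1) and the bottom
polygon b_0, ..., b_(n-1), with b_i joined to t_i and t_(i+1).  All faces are
triangles, and a triangle is labelled coherently as soon as its labels are
cyclically increasing.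

Label every edge t_i b_i by 0 and every edge b_i t_(i+1) by 1.  In each triangle
of the band these two edges follow one another in this order, so the triangle
is coherent whenever its third edge, which lies on one of the two polygons, has
a label greater than 1.  The labels around T and around B can then be chosen
independently of each other.  Around T, the labels 2, 3, 4, ..., 2n+1 are
assigned in turn to T t_0, t_0 t_1, T t_1, t_1 t_2, ..., T t_(n-1),
t_(n-1) t_0, so that the triangles at T have labels (c, c+1, c+2), except the
last one, which has (2n, 2n+1, 2).  Around B the sense of rotation is opposite,
as the polygon is seen from the other side: the labels 3, 4, 5, ..., 2n+2 are
assigned in turn to b_0 b_(n-1), B b_(n-1), b_(n-1) b_(n-2), ..., b_1 b_0, B b_0.

The labelling is given by a symmetric function of the two endpoints of an edge
([gyro_label]); [coherently_labellable_of_sym] turns such a function into a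
labelling of edges and carries it along an isomorphism. *)

Set Implicit Arguments.
Unset Strict Implicit.
Unset Printing Implicit Defensive.

Section CyclicSequences.

Lemma darts_rot (T : Type) (k : nat) (f : seq T) :
  darts (rot k f) = rot k (darts f).
Proof.
rewrite -[RHS]zip_unzip /unzip1 /unzip2 !map_rot -/(unzip1 _) -/(unzip2 _).
by rewrite unzip1_darts unzip2_darts rot_rot.
Qed.

(** Whether some rotation of [s] satisfies [Q] does not depend on where [s] starts. *)
Lemma exists_rot (T : Type) (Q : pred (seq T)) (m : nat) (s : seq T) :
  (exists k, Q (rot k (rot m s))) -> exists k, Q (rot k s).
Proof. by case=> k; rewrite rot_rot_add => Qk; exists (rot_add s m k). Qed.

(** For a triangle, coherence means that the labels are cyclically increasing. *)
Lemma sorted_rot3 (a b c : nat) :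
  [|| a < b < c, b < c < a | c < a < b] ->
  exists k, sorted (fun x y : int => (x < y)%R)
    (rot k [:: Posz a; Posz b; Posz c]).
Proof.
by case/or3P=> h; [exists 0 | exists 1 | exists 2]; rewrite /rot /=; lia.
Qed.

End CyclicSequences.

Section SymmetricLabels.

(** The labelling of unordered pairs given by a function of two arguments; it
is meaningful for symmetric functions only. *)
Definition pair_label (T : finType) (L : T -> T -> int) (S : {set T}) : int :=
  if [pick e : T * T | S == [set e.1; e.2]] is Some e then L e.1 e.2 else 0%R.

Lemma pair_labelE (T : finType) (L : T -> T -> int) (x y : T) :
  (forall a b, L a b = L b a) -> pair_label L [set x; y] = L x y.
Proof.
move=> symL; rewrite /pair_label; case: pickP => [[a b] /= /eqP E|/(_ (x, y))].
  have := set21 x y; have := set22 x y; rewrite E !inE.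
  have := set21 a b; have := set22 a b; rewrite -E !inE.
  by do 4![case/orP=> /eqP ?]; subst.
by rewrite eqxx.
Qed.

(** It suffices to label the edges of an isomorphic complex, by a symmetric
function of their endpoints. *)
Lemma coherently_labellable_of_sym (P : polyhedron) (D : face_complex)
    (L : vertex D -> vertex D -> int) :
  isomorphic P D -> (forall x y, L x y = L y x) ->
  (forall f, f \in faces D -> exists k,
    sorted (fun a b : int => (a < b)%R) (rot k [seq L e.1 e.2 | e <- darts f])) ->
  coherently_labellable P.
Proof.
case=> phi _ faceP symL cohL.
pose L' x y := L (phi x) (phi y).
have symL' x y : L' x y = L' y x by exact: symL.
exists (pair_label L') => f fP.
have [m mD] : has_face (map phi f) by apply/faceP; exists 0; rewrite rot0.
have [k] := cohL _ mD; rewrite darts_rot darts_map map_rot -map_comp => sk.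
rewrite /face_edges -map_comp.
rewrite (eq_map (_ : _ =1 (fun e => L' e.1 e.2))); last first.
  by move=> e /=; rewrite pair_labelE.
by apply: (@exists_rot _ (sorted _) m); exists k.
Qed.

End SymmetricLabels.

Section GyroelongatedBipyramid.

Variable n : nat.

Lemma mem_darts_antiprism_top (e : ('I_n + 'I_n) * ('I_n + 'I_n)) :
  e \in darts (antiprism_top n) -> exists i, e = (inl i, inl (ordS i)).
Proof.
by rewrite darts_map darts_enum_ord -map_comp => /mapP[i _ ->]; exists i.
Qed.

Lemma mem_darts_antiprism_bottom (e : ('I_n + 'I_n) * ('I_n + 'I_n)) :
  e \in darts (antiprism_bottom n) -> exists i, e = (inr (ordS i), inr i).
Proof.
rewrite (perm_mem (perm_darts_rev _)) darts_map darts_enum_ord -!map_comp.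
by case/mapP=> i _ ->; exists i.
Qed.

(** A case analysis over the four families of triangles: around T, the two of
the band, and around B. *)
Lemma gyroelongated_bipyramid_faceP
    (Q : seq (vertex (gyroelongated_bipyramid_complex n)) -> Prop) :
  (forall i : 'I_n,
    [/\ Q [:: Some None; Some (Some (inl i)); Some (Some (inl (ordS i)))],
        Q [:: Some (Some (inl (ordS i))); Some (Some (inl i)); Some (Some (inr i))],
        Q [:: Some (Some (inr i)); Some (Some (inr (ordS i))); Some (Some (inl (ordS i)))]
      & Q [:: None; Some (Some (inr (ordS i))); Some (Some (inr i))]]) ->
  forall f, f \in faces (gyroelongated_bipyramid_complex n) -> Q f.
Proof.
move=> QP f; rewrite mem_cat => /orP[/mapP[g]|/mapP[e]]; last first.
  rewrite darts_map => /mapP[e' /mem_darts_antiprism_bottom[i ->] ->] ->.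
  by case: (QP i).
rewrite mem_filter mem_cat => /andP[gb /orP[/mapP[h]|/mapP[e]]]; last first.
  by case/mem_darts_antiprism_top=> i -> -> ->; case: (QP i).
rewrite mem_filter !inE mem_cat => /andP[/negPf-> /=] hF Eg Ef; subst f g.
case/or3P: hF gb => [/eqP->|/mapP[i _ ->] _|/mapP[i _ ->] _].
(* The bottom polygon is no longer a face. *)
- by rewrite eqxx.
- by case: (QP i).
- by case: (QP i).
Qed.

(** The label of the edge joining [x] and [y].  [None] is the apex B attached to
the bottom polygon, [Some None] the apex T.  Two vertices of the same polygon
with non-consecutive indices can only be joined if the indices are [0] and
[n.-1].  The edge joining t_i and b_j has label 0 if [i = j] and 1 otherwise.
The values at pairs which are not edges are irrelevant, but they have to be
symmetric. *)
Definition gyro_label (x y : option (option ('I_n + 'I_n))) : nat :=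
  match x, y with
  | Some None, Some (Some (inl i)) | Some (Some (inl i)), Some None => i.*2.+2
  | None, Some (Some (inr i)) | Some (Some (inr i)), None => (n - i).*2.+2
  | Some (Some (inl i)), Some (Some (inl j)) =>
      if (i <= j.+1) && (j <= i.+1) then (i + j).+2 else n.*2.+1
  | Some (Some (inr i)), Some (Some (inr j)) =>
      if (i <= j.+1) && (j <= i.+1) then (n.*2 - (i + j)).+2 else 3
  | Some (Some (inl i)), Some (Some (inr j))
  | Some (Some (inr j)), Some (Some (inl i)) => i != j
  | _, _ => 0
  end.

Lemma gyro_labelC x y : gyro_label x y = gyro_label y x.
Proof.
by case: x y => [[[i|i]|]|] [[[j|j]|]|] //=; rewrite andbC addnC.
Qed.

(** The successor is [i.+1], except from [n.-1] to [0]. *)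
Lemma val_ordS (i : 'I_n) :
  val (ordS i) = if i.+1 == n then 0 else i.+1.
Proof.
rewrite /=; case: eqP => [->|ne]; first by rewrite modnn.
by rewrite modn_small //; have := ltn_ord i; lia.
Qed.

Lemma gyro_label_coherent : 2 < n ->
  forall f, f \in faces (gyroelongated_bipyramid_complex n) -> exists k,
    sorted (fun a b : int => (a < b)%R)
      (rot k [seq Posz (gyro_label e.1 e.2) | e <- darts f]).
Proof.
move=> n_gt2; apply: gyroelongated_bipyramid_faceP => i.
have := ordS_neq i n_gt2; have := ltn_ord i; have := val_ordS i.
rewrite /darts /rot /=; move: (ordS i) => j ES lt_in neS.
split; apply: sorted_rot3; rewrite /= ?eqxx ?neS {}ES;
  case: (eqVneq i.+1 n) => ?; repeat case: ifP => ?; lia.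
Qed.

End GyroelongatedBipyramid.

Theorem theorem8p5 (n : nat) (hn : 3 <= n) (P : polyhedron)
    (hP : is_gyroelongated_bipyramid n P) :
  coherently_labellable P.
Proof.
pose L x y := Posz (@gyro_label n x y).
have symL x y : L x y = L y x by rewrite /L gyro_labelC.
exact: (coherently_labellable_of_sym hP symL (gyro_label_coherent hn)).
Qed.
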